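(* For every Polish group $G$ there is a Polish space $\mathbb{U}_G$ with a continuous (global) action of $G$ on $\mathbb{U}_G$ such that for every Polish space $\mathbb{X}$ and every continuous partial action $m$ of $G$ on $\mathbb{X}$ with $G*\mathbb{X}$ clopen in $G\times\mathbb{X}$, there is a subset $\mathbb{Y}\subseteq\mathbb{U}_G$ (not necessarily invariant) such that $m$ is Borel isomorphic to the partial action of $G$ on $\mathbb{Y}$ induced by the action of $G$ on $\mathbb{U}_G$.
   Context: A Polish space (group) is a separable, completely metrizable topological space (group). A partial action of a group $G$ (identity $1$) on a set $\mathbb{X}$ is a partially defined function $m$ from $G\times\mathbb{X}$ to $\mathbb{X}$, written $(g,x)\mapsto g\cdot x$, such that for all $g,h\in G$, $x\in\mathbb{X}$: (PA1) if $g\cdot x$ is defined then $g^{-1}\cdot(g\cdot x)$ is defined and equals $x$; (PA2) if $g\cdot(h\cdot x)$ is defined then $(gh)\cdot x$ is defined and $g\cdot(h\cdot x)=(gh)\cdot x$; (PA3) $1\cdot x$ is defined and equals $x$. Put $G*\mathbb{X}=\{(g,x)\in G\times\mathbb{X}: g\cdot x \text{ is defined}\}$, $\mathbb{X}_{g^{-1}}=\{x\in\mathbb{X}: g\cdot x\text{ is defined}\}$, and let $m_g:\mathbb{X}_{g^{-1}}\to\mathbb{X}_g$, $x\mapsto g\cdot x$ (a bijection). For a topological group $G$ and a topological space $\mathbb{X}$, the partial action is topological if each $\mathbb{X}_g$ is open in $\mathbb{X}$ and each $m_g$ is a homeomorphism; it is continuous if moreover $m:G*\mathbb{X}\to\mathbb{X}$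 is continuous, where $G*\mathbb{X}$ has the subspace topology of the product. If $u:G\times\mathbb{U}\to\mathbb{U}$ is an action and $\mathbb{Y}\subseteq\mathbb{U}$, the induced partial action on $\mathbb{Y}$ has $\mathbb{Y}_g=\mathbb{Y}\cap u_g(\mathbb{Y})$, and the partial map of $g$ is the restriction of $u_g$ to $\mathbb{Y}_{g^{-1}}$. Two partial actions $m=\{m_g:\mathbb{X}_{g^{-1}}\to\mathbb{X}_g\}_{g\in G}$ and $\theta=\{\theta_g:\mathbb{Y}_{g^{-1}}\to\mathbb{Y}_g\}_{g\in G}$ are Borel isomorphic if there is a Borel isomorphism $\phi:\mathbb{X}\to\mathbb{Y}$ (a Borel measurable bijection with Borel measurable inverse) such that $\phi(\mathbb{X}_g)=\mathbb{Y}_g$ for all $g\in G$ and $\phi(m_g(x))=\theta_g(\phi(x))$ for all $g\in G$, $x\in\mathbb{X}_{g^{-1}}$. *)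

(* Defs.v *)
From HB Require Import structures.
From mathcomp Require Import all_boot all_order all_algebra.
From mathcomp Require Import all_classical all_reals all_analysis.

Set Implicit Arguments.
Unset Strict Implicit.
Unset Printing Implicit Defensive.

Import Order.TTheory GRing.Theory Num.Theory.
Import numFieldNormedType.Exports.

Local Open Scope classical_set_scope.
Local Open Scope ring_scope.
Local Open Scope group_scope.

Section polish.
Context (R : realType).

Definition is_metric (T : Type) (d : T -> T -> R) : Prop :=
  [/\ forall x y, 0 <= d x y,
      forall x y, d x y = 0 <-> x = y,
      forall x y, d x y = d y x &
      forall x y z, d x z <= d x y + d y z]%R.

Definition induces_topology (T : topologicalType) (d : T -> T -> R) : Prop :=
  forall (x : T) (A : set T),
    nbhs x A <-> exists2 e : R, (0 < e)%R & [set y | d x y < e]%R `<=` A.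

Definition complete_metric (T : topologicalType) (d : T -> T -> R) : Prop :=
  forall v : nat -> T,
    (forall e : R, (0 < e)%R -> exists N : nat, forall i j : nat,
       (N <= i)%N -> (N <= j)%N -> (d (v i) (v j) < e)%R) ->
    exists l : T, v @ \oo --> l.

Definition completely_metrizable (T : topologicalType) : Prop :=
  exists d : T -> T -> R,
    [/\ is_metric d, induces_topology d & complete_metric d].

Definition separable (T : topologicalType) : Prop :=
  exists2 D : set T, countable D & dense D.

Definition polish (T : topologicalType) : Prop :=
  separable T /\ completely_metrizable T.

End polish.

HB.mixin Record isTopologicalGroup G & Topological G & monoid.Group G := {
  mulg_continuous : continuous (fun xy : G * G => xy.1 * xy.2) ;
  invg_continuous : continuous (fun x : G => x^-1)
}.

#[short(type="topologicalGroupType")]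
HB.structure Definition TopologicalGroup :=
  {G of Topological G & monoid.Group G & isTopologicalGroup G}.

Record global_action (G : groupType) (U : Type) := GlobalAction {
  gact :> G -> U -> U ;
  gact1 : forall x, gact 1 x = x ;
  gactM : forall g h x, gact (g * h) x = gact g (gact h x)
}.

Definition continuous_action (G : topologicalGroupType) (U : topologicalType)
    (u : global_action G U) : Prop :=
  continuous (fun gx : G * U => u gx.1 gx.2).

(* [m g x = Some y] means that g . x is defined and equal to y, and
   [m g x = None] that g . x is undefined. *)
Record partial_action (G : groupType) (X : Type) := PartialAction {
  pact :> G -> X -> option X ;
  pactV : forall g x y, pact g x = Some y -> pact g^-1 y = Some x ;
  pactM : forall g h x y z,
    pact h x = Some y -> pact g y = Some z -> pact (g * h) x = Some z ;
  pact1 : forall x, pact 1 x = Some x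
}.

Section partial_action_domains.
Context (G : groupType) (X : Type) (m : partial_action G X).

(* G * X *)
Definition pact_dom : set (G * X) := [set gx | m gx.1 gx.2 <> None].

(* X_g, so that X_{g^-1} = {x | g . x is defined} is [pact_set g^-1] *)
Definition pact_set (g : G) : set X := [set x | m g^-1 x <> None].

(* Total extension of m_g; its values outside X_{g^-1} are irrelevant. *)
Definition pact_fun (g : G) (x : X) : X := odflt x (m g x).

Lemma pact_setV (g : G) : pact_set g^-1 = [set x | m g x <> None].
Proof. by rewrite /pact_set invgK. Qed.

Lemma pact_funE (g : G) (x : X) :
  pact_set g^-1 x -> m g x = Some (pact_fun g x).
Proof. by rewrite pact_setV /pact_fun /=; case: (m g x). Qed.

End partial_action_domains.

Definition homeomorphism_on (X : topologicalType) (A B : set X) (f : X -> X) :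
    Prop :=
  set_bij A B f /\
  exists f' : X -> X,
    [/\ set_fun B A f', {in A, cancel f f'}, {in B, cancel f' f},
        {within A, continuous f} & {within B, continuous f'}].

Definition topological_pact (G : topologicalGroupType) (X : topologicalType)
    (m : partial_action G X) : Prop :=
  (forall g : G, open (pact_set m g)) /\
  (forall g : G, homeomorphism_on (pact_set m g^-1) (pact_set m g)
                                  (pact_fun m g)).

Definition continuous_pact (G : topologicalGroupType) (X : topologicalType)
    (m : partial_action G X) : Prop :=
  topological_pact m /\
  {within pact_dom m, continuous (fun gx : G * X => pact_fun m gx.1 gx.2)}.

Section induced.
Context (G : groupType) (U : Type) (u : global_action G U) (Y : set U).

Definition induced_fun (g : G) (y : Y) : option Y := insub (u g (val y)).

Lemma induced_funP (g : G) (y z : Y) :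
  induced_fun g y = Some z <-> u g (val y) = val z.
Proof.
rewrite /induced_fun; split=> [|->]; last by rewrite valK.
by case: insubP => // w _ <- [->].
Qed.

Lemma induced_funV (g : G) (y z : Y) :
  induced_fun g y = Some z -> induced_fun g^-1 z = Some y.
Proof.
by move=> /induced_funP yz; apply/induced_funP; rewrite -yz -gactM mulVg gact1.
Qed.

Lemma induced_funM (g h : G) (x y z : Y) :
  induced_fun h x = Some y -> induced_fun g y = Some z ->
  induced_fun (g * h) x = Some z.
Proof.
by move=> /induced_funP xy /induced_funP yz; apply/induced_funP; rewrite gactM xy.
Qed.

Lemma induced_fun1 (y : Y) : induced_fun 1 y = Some y.
Proof. by apply/induced_funP; rewrite gact1. Qed.

Definition induced_pact : partial_action G Y :=
  PartialAction induced_funV induced_funM induced_fun1.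

Lemma induced_pact_setE (g : G) :
  val @` pact_set induced_pact g = Y `&` (u g @` Y).
Proof.
apply/seteqP; split=> [_ [y /= yg <-]|x [Yx [y Yy yx]]] /=.
  split; first exact/set_mem/valP.
  case e: (induced_fun g^-1 y) yg => [z|] // _.
  exists (val z); first exact/set_mem/valP.
  by move/induced_funP: e => <-; rewrite -gactM mulgV gact1.
exists (exist _ x (mem_set Yx)) => //=.
have e : induced_fun g^-1 (exist _ x (mem_set Yx)) =
    Some (exist _ y (mem_set Yy) : Y).
  by apply/induced_funP; rewrite /= -yx -gactM mulVg gact1.
by move=> ye; have := etrans (esym ye) e.
Qed.

End induced.

Definition borel_set (T : topologicalType) : set (set T) := <<s @open T >>.

Definition borel_fun (S T : topologicalType) (f : S -> T) : Prop :=
  forall B : set T, borel_set B -> borel_set (f @^-1` B).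

Definition borel_isomorphism (S T : topologicalType) (f : S -> T) : Prop :=
  exists f' : T -> S,
    [/\ cancel f f', cancel f' f, borel_fun f & borel_fun f'].

Definition borel_isomorphic (G : groupType) (X Y : topologicalType)
    (m : partial_action G X) (theta : partial_action G Y) : Prop :=
  exists phi : X -> Y,
    [/\ borel_isomorphism phi,
        forall g : G, phi @` pact_set m g = pact_set theta g &
        forall (g : G) (x : X), pact_set m g^-1 x ->
          omap phi (m g x) = theta g (phi x)].

(* Main.v *)
Require Import Defs.
From HB Require Import structures.
From mathcomp Require Import all_boot all_order all_algebra.
From mathcomp Require Import all_classical all_reals all_analysis.
From mathcomp Require Import lra zify.

Set Implicit Arguments.
Unset Strict Implicit.
Unset Printing Implicit Defensive.

Import Order.TTheory GRing.Theory Num.Theory.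
Import numFieldNormedType.Exports.

Local Open Scope classical_set_scope.
Local Open Scope ring_scope.
Local Open Scope group_scope.

(** Following Birkhoff and Kakutani, [G] has a length function [l] such that
    [l (g * h^-1)] is a right-invariant compatible metric. The universal space
    consists of the sequences of functions [G -> [0, 1]] that are 1-Lipschitz for
    this metric, with the topology of pointwise convergence, on which [G] acts by
    right translation of the argument. By equicontinuity this space is Polish and
    the action is continuous.

    Given a partial action on [X] and a basis [V_n] of [X], send [x] to the
    sequence of truncated distance functions to the sets
    [{h | h . x is defined and lies in V_n}]. This map is equivariant. When
    [G * X] is closed, the vanishing of the [n]-th function at [g] forces [g . x]
    to be defined and to lie in the closure of [V_n]; at [g = 1] this gives
    injectivity and a Borel inverse, and at general [g] it shows that [g . x] is
    defined as soon as the translate by [g] of the image of [x] is again in the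
    image. *)

(** * Limits and small neighbourhoods in topological groups *)

Section topological_group.
Context (G : topologicalGroupType).

Lemma cvg_mulg (T : Type) (F : set_system T) (FF : Filter F) (a b : T -> G)
    (x y : G) :
  a @ F --> x -> b @ F --> y -> (fun t => a t * b t) @ F --> x * y.
Proof.
move=> ax ay.
exact: (cvg_comp2 ax ay (@mulg_continuous G (x, y))).
Qed.

Lemma cvg_invg (T : Type) (F : set_system T) (FF : Filter F) (a : T -> G)
    (x : G) :
  a @ F --> x -> (fun t => (a t)^-1) @ F --> x^-1.
Proof. by move=> ax; exact: (cvg_comp a _ ax (@invg_continuous G x)). Qed.

(** Continuity of the triple product at the identity gives three neighbourhoods; their intersection,
    made symmetric, serves as [B]. Iterating this yields the chain of neighbourhoods in the
    Birkhoff-Kakutani construction. *)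
Lemma nbhs1_cube (A : set G) : nbhs 1 A ->
  exists B : set G, [/\ nbhs 1 B, forall g, B g -> B g^-1 &
    forall a b c, B a -> B b -> B c -> A (a * b * c)].
Proof.
move=> A1.
have : (fun t : (G * G) * G => t.1.1 * t.1.2 * t.2) @ nbhs ((1, 1), 1) --> (1 : G).
  rewrite -[X in _ --> X](mulg1 1) -[X in _ --> X * _](mulg1 1).
  apply: cvg_mulg; last exact: cvg_snd.
  apply: cvg_mulg.
    by apply: cvg_comp; [exact: cvg_fst|exact: cvg_fst].
  by apply: cvg_comp; [exact: cvg_fst|exact: cvg_snd].
move=> /(_ _ A1) [[P Q]] /= [[[P1 P2]] /= [P11 P21] P12P Q1] PQA.
pose C := P1 `&` P2 `&` Q.
have C1 : nbhs 1 C by apply: filterI => //; apply: filterI.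
exists (C `&` [set g | C g^-1]); split.
- apply: filterI => //.
  by apply: (@invg_continuous G 1); rewrite invg1.
- by move=> g [Cg CVg]; split=> //=; rewrite invgK.
- move=> a b c [[[P1a _] _] _] [[[_ P2b] _] _] [[_ Qc] _].
  by apply: (PQA ((a, b), c)); split => //=; exact: (P12P (a, b)).
Qed.

End topological_group.

(** * The Birkhoff-Kakutani length function *)

Section length_function.
Context (R : realType) (G : topologicalGroupType).

Definition is_length (l : G -> R) :=
  [/\ l 1 = 0%R, forall g, (0 <= l g)%R, forall g, l g^-1 = l g,
      forall g h, (l (g * h)%g <= l g + l h)%R &
      forall A, nbhs 1 A <-> exists2 e : R, (0 < e)%R & [set g | l g < e]%R `<=` A].

Section chains.
Context (N : nat -> set G).
Hypothesis N0 : N 0%N = setT.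
Hypothesis N1 : forall n, N n 1.
Hypothesis NV : forall n g, N n g -> N n g^-1.
Hypothesis N3 : forall n a b c,
  N n.+1 a -> N n.+1 b -> N n.+1 c -> N n (a * b * c).

Fixpoint chain_prod (s : seq nat) : set G :=
  if s is n :: s' then [set g | exists a b, [/\ N n a, chain_prod s' b & g = a * b]]
  else [set 1].

Definition chain_weight (s : seq nat) : R := (\sum_(n <- s) 2^-1 ^+ n)%R.

(** The least cost of writing [g] as a product of factors, where a factor taken from [N n] costs
    2^-n. *)
Definition chain_length (g : G) : R :=
  inf [set chain_weight s | s in [set s | chain_prod s g]].

Let W_nil : chain_weight [::] = 0%R.
Proof. by rewrite /chain_weight big_nil. Qed.

Let W_cons n s : chain_weight (n :: s) = (2^-1 ^+ n + chain_weight s)%R.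
Proof. by rewrite /chain_weight big_cons. Qed.

Let W_cat s t : chain_weight (s ++ t) = (chain_weight s + chain_weight t)%R.
Proof. by rewrite /chain_weight big_cat. Qed.

Let W_rev s : chain_weight (rev s) = chain_weight s.
Proof. by rewrite /chain_weight big_rev. Qed.

Let half_gt0 n : (0 < 2^-1 ^+ n :> R)%R.
Proof. by rewrite exprn_gt0// invr_gt0. Qed.

Let W_ge0 s : (0 <= chain_weight s)%R.
Proof. by apply: sumr_ge0 => n _; rewrite ltW. Qed.

Lemma chain_prod_cat s t g h :
  chain_prod s g -> chain_prod t h -> chain_prod (s ++ t) (g * h).
Proof.
elim: s g => [|n s IH] g /=; first by move=> ->; rewrite mul1g.
move=> [a [b [Na sb ->]]] th; exists a, (b * h); split=> //; last by rewrite mulgA.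
exact: IH.
Qed.

Lemma chain_prod_split s t g : chain_prod (s ++ t) g ->
  exists a b, [/\ chain_prod s a, chain_prod t b & g = a * b].
Proof.
elim: s g => [|n s IH] g /=; first by move=> tg; exists 1, g; rewrite mul1g.
move=> [a [b [Na /IH[c [d [sc td ->]]] ->]]].
by exists (a * c), d; split=> //; [exists a, c|rewrite mulgA].
Qed.

Lemma chain_prod1 n g : chain_prod [:: n] g <-> N n g.
Proof.
split=> [/= [a [b [Na -> ->]]]|Ng]; first by rewrite mulg1.
by exists g, 1; rewrite mulg1.
Qed.

Lemma chain_prodV s g : chain_prod s g -> chain_prod (rev s) g^-1.
Proof.
elim: s g => [|n s IH] g /=; first by move=> ->; rewrite invg1.
move=> [a [b [Na sb ->]]]; rewrite invgM rev_cons -cats1.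
by apply: chain_prod_cat; [exact: IH|apply/chain_prod1/NV].
Qed.

Lemma chain_nested n k : (n <= k)%N -> N k `<=` N n.
Proof.
move=> /subnK <-; elim: (k - n)%N => [//|i IH] g; rewrite addSn => Ng.
by apply: IH; rewrite -[g](mulg1) -[g](mulg1); apply: N3.
Qed.

(** The term [a] is the one at which the partial sums first reach [e]. *)
Lemma chain_weight_split s (e : R) : (0 < e <= chain_weight s)%R ->
  exists s1 a s2, [/\ s = s1 ++ a :: s2, (chain_weight s1 < e)%R &
    (e <= chain_weight s1 + 2^-1 ^+ a)%R].
Proof.
elim: s e => [|n s IH] e; first by rewrite W_nil; lra.
move=> /andP[e0]; rewrite W_cons => es.
have [en|ne] := leP e (2^-1 ^+ n)%R.
  by exists [::], n, s; rewrite W_nil add0r.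
have [|s1 [a [s2 [-> s1e es1]]]] := IH (e - 2^-1 ^+ n)%R; first lra.
by exists (n :: s1), a, s2; rewrite W_cons; split=> //; lra.
Qed.

(* The factor with which the weight of the chain first reaches half of the
   bound leaves two chains of weight less than that half. *)
Lemma chain_prod_sub n s : (chain_weight s < 2^-1 ^+ n)%R ->
  chain_prod s `<=` N n.
Proof.
have [k] := ubnP (size s); elim: k => // k IH in s n *.
rewrite ltnS => sk Ws g sg.
have e0 := half_gt0 n.+1.
have en : (2^-1 ^+ n = 2 * 2^-1 ^+ n.+1 :> R)%R.
  by rewrite exprS mulrA divff ?mul1r.
have split3 s1 a s2 : s = s1 ++ a :: s2 ->
    (chain_weight s1 < 2^-1 ^+ n.+1)%R -> (chain_weight s2 < 2^-1 ^+ n.+1)%R ->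
    N n g.
  move=> sE s1e s2e.
  (* A factor of index at most [n] would by itself weigh 2^-n or more; hence the middle factor lies
     in [N n.+1]. *)
  have an : (n < a)%N.
    rewrite ltnNge; apply/negP => an; move: Ws; rewrite sE W_cat W_cons.
    have : (2^-1 ^+ n <= 2^-1 ^+ a :> R)%R.
      by rewrite ler_wiXn2l// ?invr_ge0 ?invf_le1// ler1n.
    by have := W_ge0 s1; have := W_ge0 s2; lra.
  move: sg; rewrite sE => /chain_prod_split[b [c [sb /= [d [f [Nd sf ->]]] ->]]].
  rewrite mulgA; apply: N3.
  - by apply: (IH s1 n.+1) => //; move: sk; rewrite sE size_cat /=; lia.
  - exact: chain_nested Nd.
  - by apply: (IH s2 n.+1) => //; move: sk; rewrite sE size_cat /=; lia.
have [es|se] := leP (2^-1 ^+ n.+1)%R (chain_weight s).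
  have [|s1 [a [s2 [sE s1e es1]]]] := @chain_weight_split s (2^-1 ^+ n.+1)%R.
    by rewrite e0.
  by apply: (split3 s1 a s2) => //; move: Ws; rewrite sE W_cat W_cons; lra.
(* The whole chain is lighter than half the bound. Its first factor then serves as the middle one,
   after an empty prefix, so that the size still drops. *)
case: s => [|a s] in sk Ws sg split3 se *.
  by move: sg => /= ->.
apply: (split3 [::] a s); rewrite ?W_nil//.
by move: se; rewrite W_cons; have := half_gt0 a; lra.
Qed.

Let lengths_lb g : has_lbound [set chain_weight s | s in [set s | chain_prod s g]].
Proof. by exists 0%R => _ [s _ <-]. Qed.

(** As [N 0] is the whole group, one factor of index 0 reaches every [g]. *)
Let lengths_ex g : [set chain_weight s | s in [set s | chain_prod s g]] !=set0.
Proof.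
by exists (chain_weight [:: 0%N]), [:: 0%N] => //; apply/chain_prod1; rewrite N0.
Qed.

Lemma chain_length_le s g : chain_prod s g -> (chain_length g <= chain_weight s)%R.
Proof. by move=> sg; apply: (ge_inf (lengths_lb g)); exists s. Qed.

Lemma chain_length_lt g e : (chain_length g < e)%R ->
  exists2 s, chain_prod s g & (chain_weight s < e)%R.
Proof. by move=> /(inf_lt (lengths_ex g))[_ [s sg <-] se]; exists s. Qed.

Let length_ge0 g : (0 <= chain_length g)%R.
Proof. by apply: lb_le_inf => // _ [s _ <-]. Qed.

Let length_leV g : (chain_length g^-1%g <= chain_length g)%R.
Proof.
apply: lb_le_inf => // _ [s sg <-].
by rewrite -W_rev; exact/chain_length_le/chain_prodV.
Qed.

Hypothesis N_nbhs : forall n, nbhs 1 (N n).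
Hypothesis N_basis : forall A, nbhs 1 A -> exists n, N n `<=` A.

(** Reversing chains gives symmetry and concatenating them gives subadditivity. Balls are small by
    [chain_prod_sub], and they are neighbourhoods because an element of [N n] has length at most
    2^-n. *)
Lemma chain_length_is_length : is_length chain_length.
Proof.
split.
- apply/eqP; rewrite eq_le length_ge0 andbT -W_nil; exact: chain_length_le.
- exact: length_ge0.
- move=> g; apply/eqP; rewrite eq_le length_leV /=.
  by rewrite -{1}[g]invgK length_leV.
- move=> g h; apply/ler_addgt0Pr => e e0.
  have [|s sg se] := @chain_length_lt g (chain_length g + e / 2)%R; first lra.
  have [|t th te] := @chain_length_lt h (chain_length h + e / 2)%R; first lra.
  apply: le_trans (chain_length_le (chain_prod_cat sg th)) _.
  by rewrite W_cat; lra.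
- move=> A; split=> [/N_basis[n NA]|[e e0 eA]].
    exists (2^-1 ^+ n)%R; first exact: half_gt0.
    by move=> g /= /chain_length_lt[s sg se]; apply/NA/chain_prod_sub/sg.
  have [n _ /(_ n (leqnn n))/= ne] := near_infty_natSinv_expn_lt (PosNum e0).
  apply: filterS (N_nbhs n) => g Ng; apply: eA => /=.
  have /chain_length_le : chain_prod [:: n] g by apply/chain_prod1.
  move=> /le_lt_trans; apply.
  by rewrite W_cons W_nil addr0 exprVn -div1r.
Qed.

End chains.

Lemma length_exists : completely_metrizable R G -> exists l : G -> R, is_length l.
Proof.
move=> [d [[d0 dE dC dT] dtop _]].
have /choice[f fP] (A : set G) : exists B : set G, nbhs 1 A ->
    [/\ nbhs 1 B, forall g, B g -> B g^-1 &
      forall a b c, B a -> B b -> B c -> A (a * b * c)].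
  have [/nbhs1_cube[B BP]|nA] := pselect (nbhs 1 A); first by exists B.
  by exists setT.
pose ball n := [set g : G | d 1%g g < n.+1%:R^-1]%R.
have ball_nbhs n : nbhs 1 (ball n).
  by apply/dtop; exists (n.+1%:R^-1)%R.
(* Cubing into [N n'] gives the chain condition, and cubing into [ball n'] makes the sequence a base
   at 1. *)
pose N := fix N n := if n is n'.+1 then f (N n' `&` ball n') else setT.
have N_nbhs n : nbhs 1 (N n).
  elim: n => [|n IH] /=; first exact: filterT.
  by case: (fP (N n `&` ball n)) => //; apply: filterI.
have N1 n : N n 1 by exact: nbhs_singleton.
have NS n : [/\ nbhs 1 (N n.+1), forall g, N n.+1 g -> N n.+1 g^-1 &
    forall a b c, N n.+1 a -> N n.+1 b -> N n.+1 c -> (N n `&` ball n) (a * b * c)].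
  by apply: fP; apply: filterI.
exists (chain_length N); apply: chain_length_is_length => //.
- by case=> [//|n]; case: (NS n).
- by move=> n a b c Na Nb Nc; case: (NS n) => _ _ /(_ a b c Na Nb Nc)[].
- move=> A /dtop[e e0 eA].
  have [n _ /(_ n (leqnn n))/= ne] := near_infty_natSinv_lt (PosNum e0).
  exists n.+1 => g Ng; apply: eA => /=; apply: lt_trans ne.
  by case: (NS n) => _ _ /(_ g 1 1 Ng (N1 _) (N1 _))[_]; rewrite !mulg1.
Qed.

End length_function.

(** The dense sequence is kept together with the length because the metric on the universal space
    samples functions only along it. *)
Record length_frame (R : realType) (G : topologicalGroupType) := LengthFrame {
  frame_length :> G -> R ;
  frame_lengthP : is_length frame_length ;
  frame_seq : nat -> G ;
  frame_dense : forall g e, (0 < e)%R ->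
    exists j, (frame_length (g / frame_seq j)%g < e)%R
}.

Local Open Scope ring_scope.

(** * The Polish space of sequences of 1-Lipschitz functions *)

Section lipschitz_space.
Context (R : realType) (G : topologicalGroupType) (l : length_frame R G).

Record lipSpace := LipSpace {
  lip_fun :> nat -> G -> R ;
  lip_bounds : forall n g, 0 <= lip_fun n g <= 1 ;
  lip_le : forall n g h, lip_fun n g <= lip_fun n h + l (g / h)%g
}.

HB.instance Definition _ := gen_eqMixin lipSpace.
HB.instance Definition _ := gen_choiceMixin lipSpace.

Implicit Types F : lipSpace.

Lemma lipSpaceP F F' : (forall n g, F n g = F' n g) -> F = F'.
Proof.
case: F F' => [f fb fl] [f' fb' fl'] /= ff'.
have e : f = f' by apply/funext => n; apply/funext => g; exact: ff'.
by case: _ / e in fb' fl' *; congr LipSpace; exact: Prop_irrelevance.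
Qed.

Lemma frame_length_divC g h : l (g / h)%g = l (h / g)%g.
Proof. by have [_ _ lV _ _] := frame_lengthP l; rewrite -lV invgF. Qed.

Lemma lip_norm F n g h : `|F n g - F n h| <= l (g / h)%g.
Proof.
have := lip_le F n g h; have := lip_le F n h g; rewrite [l (h / g)%g]frame_length_divC.
by move=> *; rewrite ler_norml; apply/andP; split; lra.
Qed.

(** The values at the sample points, listed by codes of pairs. A number that codes no pair gets 0
    and adds nothing to the distance. *)
Definition lip_coord F (t : nat) : R :=
  if unpickle t is Some (n, j) then F n (frame_seq l j) else 0.

Lemma lip_coord_pickle F n j : lip_coord F (pickle (n, j)) = F n (frame_seq l j).
Proof. by rewrite /lip_coord pickleK. Qed.

Lemma lip_coord_bounds F t : 0 <= lip_coord F t <= 1.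
Proof.
rewrite /lip_coord; case: unpickle => [[n j]|]; first exact: lip_bounds.
by rewrite lexx ler01.
Qed.

(** With a weighted supremum in place of a series, bounding the distance means bounding each
    coordinate. The weights tend to 0, which makes convergence coordinatewise. *)
Definition lip_dist F F' : R :=
  sup (range (fun t => t.+1%:R^-1 * `|lip_coord F t - lip_coord F' t|)).

Lemma lip_dist_leP F F' e :
  lip_dist F F' <= e <-> forall t, t.+1%:R^-1 * `|lip_coord F t - lip_coord F' t| <= e.
Proof.
split=> [Fe t|Fe]; last first.
  apply: ge_sup; last by move=> _ [t _ <-].
  by exists (0.+1%:R^-1 * `|lip_coord F 0 - lip_coord F' 0|), 0%N.
apply: le_trans Fe; apply: ub_le_sup; last by exists t.
exists 1 => _ [s _ <-].
have := lip_coord_bounds F s; have := lip_coord_bounds F' s => *.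
rewrite -[leRHS]mulr1 ler_pM// ?invf_le1// ?ler1n//.
by rewrite ler_norml; apply/andP; split; lra.
Qed.

Lemma lip_coord_le F F' t :
  `|lip_coord F t - lip_coord F' t| <= t.+1%:R * lip_dist F F'.
Proof.
rewrite -ler_pdivrMl//.
by have /lip_dist_leP : lip_dist F F' <= lip_dist F F' by [].
Qed.

Lemma lip_dist_ge0 F F' : 0 <= lip_dist F F'.
Proof. by have := lip_coord_le F F' 0; rewrite mul1r; exact: le_trans. Qed.

Lemma lip_distxx F : lip_dist F F = 0.
Proof.
apply/eqP; rewrite eq_le lip_dist_ge0 andbT.
by apply/lip_dist_leP => t; rewrite subrr normr0 mulr0.
Qed.

Lemma lip_dist_sym F F' : lip_dist F F' = lip_dist F' F.
Proof. by rewrite /lip_dist; congr sup; apply/eq_imagel => t _; rewrite distrC. Qed.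

Lemma lip_dist_triangle F' F F'' :
  lip_dist F F'' <= lip_dist F F' + lip_dist F' F''.
Proof.
apply/lip_dist_leP => t; rewrite ler_pdivrMl// mulrDr.
by apply: le_trans (ler_distD (lip_coord F' t) _ _) _; rewrite lerD// lip_coord_le.
Qed.

(** Equicontinuity: some sample point is within e/3 of [g]. Moving each function there costs e/3,
    and the distance controls the difference at that point. *)
Lemma lip_eval_close n g e : 0 < e -> exists2 d, 0 < d &
  forall F F', lip_dist F F' < d -> `|F n g - F' n g| < e.
Proof.
move=> e0; have [|j gj] := @frame_dense _ _ l g (e / 3); first lra.
set t := pickle (n, j); have t0 : 0 < t.+1%:R :> R by [].
(* The factor compensates the weight of coordinate [t] in [lip_dist]. *)
exists (t.+1%:R^-1 * (e / 3)); first by rewrite mulr_gt0 ?invr_gt0//; lra.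
move=> F F'; rewrite ltr_pdivlMl// => FF'.
have := lip_coord_le F F' t; rewrite !lip_coord_pickle => c.
have := lip_norm F n g (frame_seq l j); have := lip_norm F' n g (frame_seq l j).
move: c FF' gj; move: (t.+1%:R * _) => D.
rewrite !ler_norml ltr_norml; lra.
Qed.

Lemma lip_dist_eq0 F F' : lip_dist F F' = 0 -> F = F'.
Proof.
move=> FF'; apply: lipSpaceP => n g; apply/eqP; rewrite -subr_eq0 -normr_le0.
apply/ler_addgt0Pr => e e0; rewrite add0r.
have [d d0 dF] := lip_eval_close n g e0.
by apply/ltW/dF; rewrite FF'.
Qed.

HB.instance Definition _ := isMetric.Build R lipSpace
  lip_distxx lip_dist_eq0 lip_dist_sym lip_dist_triangle.

Lemma nbhs_lipE F A :
  nbhs F A <-> exists2 e : R, 0 < e & [set F' | lip_dist F F' < e] `<=` A.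
Proof.
split=> [/nbhs_ballP[e e0]|[e e0 eA]]; first by rewrite ballEmdist; exists e.
by apply/nbhs_ballP; exists e; rewrite ?ballEmdist.
Qed.

(** Coordinates from [N] on have weight below e/2 whatever the functions are, so only finitely many
    pointwise conditions remain. *)
Lemma cvg_lipP (T : Type) (E : set_system T) (EF : Filter E) (f : T -> lipSpace) F :
  (forall n g e, 0 < e -> \forall t \near E, `|f t n g - F n g| < e) ->
  f @ E --> F.
Proof.
move=> fF A /nbhs_lipE[e e0 eA].
have e20 : 0 < e / 2 by lra.
have [N _ /(_ N (leqnn N))/= Ne] := near_infty_natSinv_lt (PosNum e20).
have : \forall t \near E, forall i : 'I_N, `|lip_coord (f t) i - lip_coord F i| < e / 2.
  apply: filter_forall => i; rewrite /lip_coord.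
  case: unpickle => [[n j]|]; first by apply: fF; lra.
  by apply: nearW => t; rewrite subrr normr0; lra.
apply: filterS => t tF; apply: eA => /=.
rewrite lip_dist_sym; apply: (@le_lt_trans _ _ (e / 2)); last lra.
apply/lip_dist_leP => s; have [sN|Ns] := ltnP s N.
  rewrite -[leRHS]mul1r ler_pM// ?invf_le1// ?ler1n//.
  exact: ltW (tF (Ordinal sN)).
rewrite -[leRHS]mulr1 ler_pM//.
  apply: le_trans (ltW Ne); rewrite lef_pV2 ?posrE// ler_nat; lia.
have := lip_coord_bounds (f t) s; have := lip_coord_bounds F s => *.
by rewrite ler_norml; apply/andP; split; lra.
Qed.

(** By [lip_eval_close] the evaluations of a Cauchy sequence are Cauchy; the bounds and the
    Lipschitz inequality pass to the pointwise limit. *)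
Lemma lip_complete : complete_metric lip_dist.
Proof.
move=> v vC.
have vcvg n g : cvgn (fun i => v i n g).
  apply/cauchy_cvgP/cauchy_exP => e e0.
  have [d d0 dF] := lip_eval_close n g e0.
  have [N NP] := vC _ d0; exists (v N n g); exists N => // i /= Ni.
  by apply: dF; exact: NP.
pose f n g := limn (fun i => v i n g).
have f_bounds n g : 0 <= f n g <= 1.
  by apply/andP; split; [apply: limr_ge|apply: limr_le] => //;
    apply: nearW => i; case/andP: (lip_bounds (v i) n g).
have f_le n g h : f n g <= f n h + l (g / h)%g.
  have c : (fun i => v i n h + l (g / h)%g) @ \oo --> f n h + l (g / h)%g.
    by apply: cvgD; [exact: vcvg|exact: cvg_cst].
  rewrite -(cvg_lim (@Rhausdorff R) c).
  apply: ler_lim => //; first by apply/cvg_ex; eexists; exact: c.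
  by apply: nearW => i; exact: lip_le.
exists (LipSpace f_bounds f_le); apply: cvg_lipP => n g e e0.
by have /cvgrPdistC_lt := vcvg n g; exact.
Qed.

Let len_ge0 g : 0 <= l g.
Proof. by have [] := frame_lengthP l. Qed.

Definition lip_zero : lipSpace.
Proof.
apply: (@LipSpace (fun _ _ => 0)) => [_ _|_ g h]; first by rewrite lexx ler01.
by rewrite add0r.
Defined.

Definition lip_code k F : seq nat :=
  [seq Num.truncn (k.+1%:R * lip_coord F t) | t <- iota 0 k.+1].

(** Coordinates up to [k] with equal roundings differ by at most 1/(k+1), and the later ones have a
    weight below 1/(k+1). *)
Lemma lip_code_close k F F' :
  lip_code k F = lip_code k F' -> lip_dist F F' <= k.+1%:R^-1.
Proof.
move=> FF'; apply/lip_dist_leP => t.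
have /andP[a0 a1] := lip_coord_bounds F t.
have /andP[b0 b1] := lip_coord_bounds F' t.
have [tk|kt] := leqP t k; last first.
  rewrite -[leRHS]mulr1 ler_pM//; first by rewrite lef_pV2 ?posrE// ler_nat; lia.
  by rewrite ler_norml; apply/andP; split; lra.
rewrite -[leRHS]mul1r ler_pM// ?invf_le1// ?ler1n//.
have tE : Num.truncn (k.+1%:R * lip_coord F t) = Num.truncn (k.+1%:R * lip_coord F' t).
  have := congr1 (nth 0%N ^~ t) FF'.
  by rewrite /= !(nth_map 0%N) ?size_iota// nth_iota// add0n.
have := @truncn_itv R (k.+1%:R * lip_coord F t); rewrite mulr_ge0// => /(_ isT).
have := @truncn_itv R (k.+1%:R * lip_coord F' t); rewrite mulr_ge0// => /(_ isT).
rewrite tE => b2 a2; have K0 : 0 < k.+1%:R :> R by [].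
rewrite -[leRHS]mulr1 ler_pdivlMl// -{1}(gtr0_norm K0) -normrM mulrBr.
move: (k.+1%:R : R) b2 a2 => K; rewrite -natr1 => /andP[b2 b3] /andP[a2 a3].
by rewrite ler_norml; apply/andP; split; lra.
Qed.

Lemma lip_separable : separable lipSpace.
Proof.
(* One representative for each code that occurs, and [lip_zero] for the others. *)
pose pt (p : nat * seq nat) := xget lip_zero [set F | lip_code p.1 F = p.2].
exists (range pt).
  by apply: sub_countable (countableP [set: nat * seq nat]); exact: card_image_le.
move=> O [F OF] oO.
have /nbhs_lipE[e e0 eO] : nbhs F O by exact: open_nbhs_nbhs.
have [k _ /(_ k (leqnn k))/= ke] := near_infty_natSinv_lt (PosNum e0).
exists (pt (k, lip_code k F)); split; last by eexists.
apply: eO => /=; apply: le_lt_trans ke; apply: lip_code_close.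
apply/esym/(@xgetPex _ lip_zero [set F' | lip_code k F' = lip_code k F]).
by exists F.
Qed.

Lemma lip_polish : polish R lipSpace.
Proof.
split; first exact: lip_separable.
exists lip_dist; split; last exact: lip_complete.
- split; [exact: lip_dist_ge0| |exact: lip_dist_sym|move=> *; exact: lip_dist_triangle].
  by move=> F F'; split; [exact: lip_dist_eq0|move=> ->; exact: lip_distxx].
- exact: nbhs_lipE.
Qed.

End lipschitz_space.

(** * The action by right translation *)

Section translation_action.
Context (R : realType) (G : topologicalGroupType) (l : length_frame R G).

(** Right-invariance of [l (g / h)] keeps the translate 1-Lipschitz, and translating the argument on
    the right gives a left action. *)
Definition lip_shift (g : G) (F : lipSpace l) : lipSpace l.
Proof.
apply: (@LipSpace _ _ _ (fun n h => F n (h * g)%g)) => [n h|n h k].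
  exact: lip_bounds.
by have := lip_le F n (h * g)%g (k * g)%g; rewrite mulgKA.
Defined.

Lemma lip_shift1 F : lip_shift 1%g F = F.
Proof. by apply: lipSpaceP => n h /=; rewrite mulg1. Qed.

Lemma lip_shiftM g h F : lip_shift (g * h)%g F = lip_shift g (lip_shift h F).
Proof. by apply: lipSpaceP => n k /=; rewrite mulgA. Qed.

Definition lip_action : global_action G (lipSpace l) :=
  GlobalAction lip_shift1 lip_shiftM.

Lemma nbhs_length_div (a : G) (e : R) : 0 < e -> \forall b \near a, l (b / a)%g < e.
Proof.
move=> e0; have [_ _ _ _ lnbhs] := frame_lengthP l.
have : (fun b : G => b / a)%g @ a --> (1 : G)%g.
  rewrite -[X in _ --> X](mulgV a); apply: cvg_mulg; first exact: cvg_id.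
  exact: cvg_cst.
by move=> /(_ [set b | l b < e]); apply; apply/lnbhs; exists e.
Qed.

(** Pass from F'(hg') to F'(hg) by the Lipschitz bound, which is uniform in F', and then to F(hg) by
    closeness of F' to F. *)
Lemma lip_action_continuous : continuous_action lip_action.
Proof.
move=> [g F]; apply: cvg_lipP => n h e e0 /=.
have e20 : 0 < e / 2 by lra.
have [d d0 dF] := lip_eval_close l n (h * g)%g e20.
have hg : \forall g' \near g, l (h * g' / (h * g))%g < e / 2.
  have c : (fun g' => h * g')%g @ g --> (h * g)%g.
    by apply: cvg_mulg; [exact: cvg_cst|exact: cvg_id].
  exact: c (nbhs_length_div _ e20).
exists ([set g' | l (h * g' / (h * g))%g < e / 2], [set F' | lip_dist F F' < d]).
  by split=> //=; apply/nbhs_lipE; exists d.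
move=> [g' F'] /= [gg' FF']; have := dF _ _ FF'; have := lip_norm F' n (h * g')%g (h * g)%g.
move: gg'; rewrite ler_norml !ltr_norml; lra.
Qed.

End translation_action.

(** * Countable bases and dense sequences from separability *)

Section polish_spaces.
Context (R : realType).

Lemma polish_basis (X : topologicalType) : polish R X ->
  exists V : nat -> set X, (forall k, open (V k)) /\
    forall x A, nbhs x A -> exists k, V k x /\ closure (V k) `<=` A.
Proof.
move=> [[D /pcard_leTP[f] Ddense] [d [[d0 dE dC dT] dtop _]]].
(* As [f] numbers [D] injectively, at most one centre [c] occurs for each [i], so the set is a
   single ball or empty. *)
pose V k := if unpickle k is Some (i, j) then
  [set x | exists2 c, D c /\ f c = i & d c x < j.+1%:R^-1] else set0.
have dopen c e : open [set x | d c x < e].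
  rewrite openE => x /= cx; apply/dtop; exists (e - d c x); first lra.
  by move=> y /= xy; have := dT c x y; lra.
exists V; split=> [k|x A /dtop[e e0 eA]].
  rewrite /V; case: unpickle => [[i j]|]; last exact: open0.
  rewrite (_ : mkset _ = \bigcup_(c in [set c | D c /\ f c = i]) [set x | d c x < j.+1%:R^-1]).
    by apply: bigcup_open => c _; exact: dopen.
  by apply/seteqP; split=> y [c Dc cy]; exists c.
(* A point of the closure is reached from [x] in three moves, through [c] and a point [z] of the
   ball, each shorter than e/4. *)
have e40 : 0 < e / 4 by lra.
have [j _ /(_ j (leqnn j))/= je] := near_infty_natSinv_lt (PosNum e40).
have [|c [/= cx Dc]] := Ddense [set y | d x y < j.+1%:R^-1] _ (dopen _ _).
  by exists x; rewrite /= (dE x x).2.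
exists (pickle (f c, j)); rewrite /V pickleK; split.
  by exists c => //; rewrite dC.
move=> y yV; apply: eA => /=.
have [|z [[c' [Dc' fc'] c'z] yz]] := yV [set z | d y z < e / 4].
  by apply/dtop; exists (e / 4).
have cc' : c' = c by apply: (@inj _ _ _ f); rewrite ?inE.
move: c'z yz; rewrite cc' /= => cz yz.
have := dT x c y; have := dT c z y; rewrite [d z y]dC.
by move: je cx cz; move: (j.+1%:R^-1) => r; lra.
Qed.

Lemma length_frame_exists (G : topologicalGroupType) :
  polish R G -> inhabited (length_frame R G).
Proof.
move=> [[D /pcard_leTP[f] Ddense] /length_exists[l lP]].
have [l1 l0 lV lM lnbhs] := lP.
(* Numbers carried by no point of [D] get the value 1. *)
pose q i := xget 1%g [set c | D c /\ f c = i].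
suff qdense g e : 0 < e -> exists j, l (g / q j)%g < e by exists; exact: LengthFrame qdense.
move=> e0.
have gN : nbhs g [set y | l (g / y)%g < e].
  have c : (fun y : G => g / y)%g @ g --> (1 : G)%g.
    rewrite -[X in _ --> X](mulgV g); apply: cvg_mulg; first exact: cvg_cst.
    by apply: cvg_invg; exact: cvg_id.
  by move/(_ [set b | l b < e]): c; apply; apply/lnbhs; exists e.
have [|c [/interior_subset/= gc Dc]] :=
    Ddense _ _ (open_interior [set y | l (g / y)%g < e]).
  by exists g.
exists (f c); rewrite /q.
have [Dc' fc'] := @xgetPex _ 1%g [set c' | D c' /\ f c' = f c]
  (ex_intro _ c (conj Dc erefl)).
by rewrite (_ : xget _ _ = c)//; apply: (@inj _ _ _ f); rewrite ?inE.
Qed.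

End polish_spaces.

(** * Truncated distance to a subset of the group *)

Section distance_to_set.
Context (R : realType) (G : topologicalGroupType) (l : length_frame R G).

(** Adding the element 1 truncates the distance and gives the value 1 when [A] is empty. *)
Definition dist_set (A : set G) (g : G) : R :=
  inf (1 |` [set l (g / h)%g | h in A]).

Let len_ge0 g : 0 <= l g.
Proof. by have [] := frame_lengthP l. Qed.

Let dist_nonempty A g : 1 |` [set l (g / h)%g | h in A] !=set0.
Proof. by exists 1; left. Qed.

Let dist_lb A g : has_lbound (1 |` [set l (g / h)%g | h in A]).
Proof. by exists 0 => _ [->|[h _ <-]]. Qed.

Lemma dist_set_le A g h : A h -> dist_set A g <= l (g / h)%g.
Proof. by move=> Ah; apply: (ge_inf (dist_lb A g)); right; exists h. Qed.

Lemma dist_set_bounds A g : 0 <= dist_set A g <= 1.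
Proof.
apply/andP; split; first by apply: lb_le_inf => // _ [->|[h _ <-]].
by apply: (ge_inf (dist_lb A g)); left.
Qed.

Lemma dist_set_lt A g e : e <= 1 ->
  dist_set A g < e <-> exists2 h, A h & l (g / h)%g < e.
Proof.
move=> e1; split=> [/(inf_lt (dist_nonempty A g))[_ [->|[h Ah <-]] he]|[h Ah he]].
- by move: (lt_le_trans he e1); rewrite ltxx.
- by exists h.
- exact: le_lt_trans (dist_set_le g Ah) he.
Qed.

Lemma dist_set_lip A g h : dist_set A g <= dist_set A h + l (g / h)%g.
Proof.
have [_ _ _ lM _] := frame_lengthP l.
rewrite -lerBlDr; apply: lb_le_inf => // _ [->|[k Ak <-]].
  by have := dist_set_bounds A g; have := len_ge0 (g / h)%g; lra.
rewrite lerBlDr; apply: le_trans (dist_set_le g Ak) _.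
by have := lM (g / h)%g (h / k)%g; rewrite mulgA mulgVK addrC.
Qed.

(** Right-invariance of the metric; this is the source of the equivariance of [embed]. *)
Lemma dist_set_translate A g h :
  dist_set [set k | A (k * g)%g] h = dist_set A (h * g)%g.
Proof.
congr (inf (_ `|` _)); apply/seteqP; split=> _ [k Ak <-].
  by exists (k * g)%g => //; rewrite mulgKA.
by exists (k / g)%g; rewrite /= ?mulgVK// -(mulgKA g h) mulgVK.
Qed.

Lemma dist_set_eq0 A g : dist_set A g = 0 -> closure A g.
Proof.
move=> Ag B gB; have [_ _ _ _ lnbhs] := frame_lengthP l.
have : (fun h : G => h * g)%g @ (1 : G)%g --> g.
  rewrite -[X in _ --> X](mul1g g); apply: cvg_mulg; [exact: cvg_id|exact: cvg_cst].
move=> /(_ _ gB)/lnbhs[e e0 eB].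
(* The minimum stays within the truncation level, as [dist_set_lt] requires. *)
have /dist_set_lt[|h Ah he] : dist_set A g < Num.min e 1 by rewrite Ag lt_min e0 ltr01.
  by rewrite ge_min lexx orbT.
exists h; split=> //; rewrite -[h](mulgVK g); apply: eB => /=.
by rewrite frame_length_divC; apply: lt_le_trans he _; rewrite ge_min lexx.
Qed.

Lemma dist_set_mem A g : A g -> dist_set A g = 0.
Proof.
move=> Ag; apply/eqP; rewrite eq_le; have /andP[-> _] := dist_set_bounds A g.
have [l1 _ _ _ _] := frame_lengthP l.
by rewrite andbT -l1 -(mulgV g); exact: dist_set_le.
Qed.

End distance_to_set.

(** * Borel sets and Borel functions *)

Section borel.
Context (T : topologicalType).
Implicit Types A B : set T.

Lemma borel_open A : open A -> borel_set A.
Proof. exact: sub_sigma_algebra. Qed.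

Lemma borel_setC A : borel_set A -> borel_set (~` A).
Proof. by rewrite -setTD; exact: (@sigma_algebraCD _ _ _ A). Qed.

Lemma borel_closed A : closed A -> borel_set A.
Proof. by move=> /closed_openC/borel_open/borel_setC; rewrite setCK. Qed.

Lemma borel_bigcup (A : nat -> set T) :
  (forall k, borel_set (A k)) -> borel_set (\bigcup_k A k).
Proof. exact: (@sigma_algebra_bigcup _ _ _ A). Qed.

Lemma borel_bigcap (A : nat -> set T) :
  (forall k, borel_set (A k)) -> borel_set (\bigcap_k A k).
Proof.
move=> bA; rewrite -[X in borel_set X]setCK setC_bigcap.
by apply: borel_setC; apply: borel_bigcup => k; exact: borel_setC.
Qed.

Lemma borel_setI A B : borel_set A -> borel_set B -> borel_set (A `&` B).
Proof.
move=> bA bB; rewrite -bigcap2E.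
by apply: borel_bigcap => -[|[|k]]//=; exact: (borel_open openT).
Qed.

End borel.

Lemma borel_funP (S T : topologicalType) (f : S -> T) :
  (forall O, open O -> borel_set (f @^-1` O)) -> borel_fun f.
Proof.
move=> fO B; pose M := [set A | borel_set (f @^-1` A)].
suff : @borel_set T `<=` M by exact.
apply: smallest_sub; last by move=> O /fO.
split=> [|A MA|A MA]; rewrite /M /=.
- by rewrite preimage_set0; exact: (borel_open open0).
- by rewrite setTD preimage_setC; exact: borel_setC.
- by rewrite preimage_bigcup; exact: borel_bigcup.
Qed.

(** * Borel maps into the Lipschitz space *)

Section lip_borel.
Context (R : realType) (G : topologicalGroupType) (l : length_frame R G).

Lemma closed_lip_eq0 n g : closed [set F : lipSpace l | F n g = 0].
Proof.
rewrite -openC openE => F /eqP F0; apply/nbhs_lipE.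
have [d d0 dF] := @lip_eval_close _ _ l n g `|F n g| ltac:(by rewrite normr_gt0).
by exists d => // F' /dF; rewrite /= => + F'0; rewrite F'0 subr0 ltxx.
Qed.

(* An open set is a countable union of closed balls with dense centres, and a
   closed ball is a countable intersection of conditions on coordinates. *)
Lemma borel_fun_lip (X : topologicalType) (f : X -> lipSpace l) :
  (forall n g e, borel_set [set x | f x n g < e]) -> borel_fun f.
Proof.
move=> fb; apply: borel_funP => O oO.
have [D /pcard_leTP[i] Ddense] := lip_separable l.
pose ctr k := xget (lip_zero l) [set c | D c /\ i c = k].
pose cball (p : nat * nat) :=
  [set F | lip_dist (ctr p.1) F <= p.2.+1%:R^-1].
pose B k := if unpickle k is Some p then
  if `[< cball p `<=` O >] then cball p else set0 else set0.
have -> : O = \bigcup_k B k.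
  apply/seteqP; split=> [F OF|F [k _]]; last first.
    rewrite /B; case: unpickle => [p|//].
    by case: ifP => [/asboolP pO|//]; exact: pO.
  have /nbhs_lipE[e e0 eO] : nbhs F O by exact: open_nbhs_nbhs.
  have e20 : 0 < e / 2 by lra.
  (* With a radius below e/2, a closed ball that contains [F] stays within distance [e] of [F]. *)
  have [j _ /(_ j (leqnn j))/= je] := near_infty_natSinv_lt (PosNum e20).
  have j0 : 0 < j.+1%:R^-1 :> R by rewrite invr_gt0.
  have Fj : nbhs F [set F' | lip_dist F F' < j.+1%:R^-1].
    by apply/nbhs_lipE; exists (j.+1%:R^-1).
  have [|c [/interior_subset/= cF Dc]] :=
      Ddense _ _ (open_interior [set F' | lip_dist F F' < j.+1%:R^-1]).
    by exists F.
  have cE : ctr (i c) = c.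
    have [Dc' ic'] := @xgetPex _ (lip_zero l) [set c' | D c' /\ i c' = i c]
      (ex_intro _ c (conj Dc erefl)).
    by apply: (@inj _ _ _ i); rewrite ?inE.
  exists (pickle (i c, j)) => //; rewrite /B pickleK asboolT /cball /= cE.
    by rewrite lip_dist_sym ltW.
  move=> F' /= cF'; apply: eO => /=; have := lip_dist_triangle c F F'.
  by move: je cF cF'; move: (j.+1%:R^-1) => r; lra.
rewrite preimage_bigcup; apply: borel_bigcup => k; rewrite /B.
case: unpickle => [p|]; last by rewrite preimage_set0; exact: (borel_open open0).
case: ifP => _; last by rewrite preimage_set0; exact: (borel_open open0).
have fbc t : forall e, borel_set [set x | lip_coord (f x) t < e].
  move=> e; rewrite /lip_coord; case: unpickle => [[n j]//|].
  by apply: borel_open; rewrite openE => x /= e0; exact: nearW.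
have fle t e : borel_set [set x | lip_coord (f x) t <= e].
  rewrite (_ : mkset _ = \bigcap_j [set x | lip_coord (f x) t < e + j.+1%:R^-1]).
    by apply: borel_bigcap => j; exact: fbc.
  apply/seteqP; split=> x /=.
    by move=> xe j _ /=; apply: le_lt_trans xe _; rewrite ltrDl invr_gt0.
  move=> xe; apply/ler_addgt0Pr => d d0.
  have [j _ /(_ j (leqnn j))/= jd] := near_infty_natSinv_lt (PosNum d0).
  by apply: le_trans (ltW (xe j Logic.I)) _; rewrite lerD2l ltW.
(* The lower bound is written as the complement of a strict upper bound, so that both conditions
   come from sublevel sets. *)
rewrite (_ : _ @^-1` _ = \bigcap_t
    ([set x | lip_coord (f x) t <= lip_coord (ctr p.1) t + t.+1%:R * p.2.+1%:R^-1] `&`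
     ~` [set x | lip_coord (f x) t < lip_coord (ctr p.1) t - t.+1%:R * p.2.+1%:R^-1])).
  apply: borel_bigcap => t; apply: borel_setI; first exact: fle.
  by apply: borel_setC; exact: fbc.
have ballE x t :
    (t.+1%:R^-1 * `|lip_coord (ctr p.1) t - lip_coord (f x) t| <= p.2.+1%:R^-1) =
    (lip_coord (ctr p.1) t - t.+1%:R * p.2.+1%:R^-1 <= lip_coord (f x) t <=
     lip_coord (ctr p.1) t + t.+1%:R * p.2.+1%:R^-1).
  by rewrite ler_pdivrMl// distrC ler_distl.
apply/seteqP; split=> x /=.
  move=> /lip_dist_leP xp t _; move: (xp t); rewrite ballE => /andP[a b]; split=> //=.
  by apply/negP; rewrite -leNgt.
move=> xp; apply/lip_dist_leP => t; rewrite ballE; have [/= a /negP] := xp t Logic.I.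
by rewrite -leNgt a andbT.
Qed.

End lip_borel.

(** * The equivariant Borel embedding of a partial action *)

Section embedding.
Context (R : realType) (G : topologicalGroupType) (l : length_frame R G).
Context (X : topologicalType) (m : partial_action G X).
Hypothesis Xpolish : polish R X.
Hypothesis mcont : continuous_pact m.
Hypothesis mclopen : clopen (pact_dom m).
Context (V : nat -> set X).
Hypothesis Vopen : forall k, open (V k).
Hypothesis Vbasis :
  forall x A, nbhs x A -> exists k, V k x /\ closure (V k) `<=` A.

Definition hitting (k : nat) (x : X) : set G :=
  [set h | exists2 y, m h x = Some y & V k y].

Definition embed (x : X) : lipSpace l :=
  LipSpace (fun n g => dist_set_bounds l (hitting n x) g)
    (fun n g h => dist_set_lip l (hitting n x) g h).

(** Undefinedness transfers as well: if [h * g] is defined at [x], composing with the inverse of [g]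
    defines [h] at [y]. *)
Lemma pact_trans g h x y : m g x = Some y -> m h y = m (h * g)%g x.
Proof.
move=> xy; case e: (m h y) => [z|]; first by rewrite (pactM xy e).
case e' : (m (h * g)%g x) => [z|//].
by have := pactM (pactV xy) e'; rewrite mulgK e.
Qed.

(** By [pact_trans], the hitting sets of [y] are those of [x] translated on the right by the inverse
    of [g]. *)
Lemma embed_equivariant g x y :
  m g x = Some y -> embed y = lip_action l g (embed x).
Proof.
move=> xy; apply: lipSpaceP => n h /=; rewrite -dist_set_translate.
congr dist_set; apply/seteqP.
by split=> k [z kz Vz]; exists z; rewrite // -kz -(pact_trans _ xy).
Qed.

(* Closedness of [G * X] makes [g . x] defined, and continuity makes it a
   limit of points [h . x] of [V n]. *)
Lemma embed_eq0 n g x : embed x n g = 0 ->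
  exists2 y, m g x = Some y & closure (V n) y.
Proof.
move=> /dist_set_eq0 gx.
have gxdom : pact_dom m (g, x).
  apply: (mclopen.2) => B [[P Q]] /= [gP xQ] PQ.
  have [h [[y hxy _] Ph]] := gx _ gP.
  exists (h, x); split; first by rewrite /pact_dom /= hxy.
  by apply: PQ; split=> //=; exact: nbhs_singleton.
case e: (m g x) gxdom => [y|]; last by rewrite /pact_dom /= e.
move=> gxdom; exists y => // B yB.
have [_ /subspace_continuousP/(_ _ gxdom) c] := mcont.
have yE : pact_fun m g x = y by rewrite /pact_fun e.
rewrite -yE in yB; have := c _ yB; rewrite /within /=.
move=> [[P Q]] /= [gP xQ] PQ.
have [h [[z hxz Vz] Ph]] := gx _ gP.
exists z; split=> //.
have := PQ (h, x); rewrite /= /from_subspace /pact_fun hxz /=; apply; last first.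
  by rewrite /pact_dom /= hxz.
by split=> //=; exact: nbhs_singleton.
Qed.

Lemma embed_mem n x : V n x -> embed x n 1%g = 0.
Proof. by move=> Vx; apply: dist_set_mem; exists x => //; exact: pact1. Qed.

Lemma embed_nbhs x A : nbhs x A ->
  exists2 k, embed x k 1%g = 0 & closure (V k) `<=` A.
Proof. by move=> /Vbasis[k [Vx VA]]; exists k => //; exact: embed_mem. Qed.

(** For [V k] around [x], the common image vanishes at [k] and 1; read for [y], this puts [y] in the
    closure of [V k], which can be taken arbitrarily small. *)
Lemma embed_inj : injective embed.
Proof.
move=> x y xy; have [_ [d [[d0 dE dC dT] dtop _]]] := Xpolish.
apply/dE/eqP; rewrite eq_le d0 andbT; apply/ler_addgt0Pr => e e0; rewrite add0r.
have [|k xk kA] := @embed_nbhs x [set z | d x z < e].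
  by apply/dtop; exists e.
move: xk; rewrite xy => /embed_eq0[z]; rewrite pact1 => -[<-] /kA.
exact: ltW.
Qed.

(** A zero of [embed y] at 1 is a zero of [embed x] at [g], so [embed_eq0] makes g . x defined;
    equivariance and injectivity identify it with [y]. *)
Lemma embed_induced g x y :
  lip_action l g (embed x) = embed y -> m g x = Some y.
Proof.
move=> xy; have [k yk _] := @embed_nbhs y setT filterT.
have /embed_eq0[z xz _] : embed x k g = 0.
  by rewrite -yk -xy /= mul1g.
by rewrite xz; congr Some; apply: embed_inj; rewrite -xy (embed_equivariant xz).
Qed.

Lemma hitting_open n h : open [set x | hitting n x h].
Proof.
have [[mopen mhom] _] := mcont.
have [_ [f' [_ _ _ mc _]]] := mhom h.
rewrite openE => x [y xy Vy].
have hx : pact_set m h^-1%g x by rewrite pact_setV /= xy.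
move/subspace_continuousP: mc => /(_ x hx) c.
have yV : nbhs (pact_fun m h x) (V n).
  by rewrite /pact_fun xy; exact: open_nbhs_nbhs.
have hN : nbhs x (pact_set m h^-1%g) by apply: open_nbhs_nbhs; split=> //; exact: mopen.
apply: filterS2 hN (c _ yV) => x' hx' /(_ hx') Vx'.
by exists (pact_fun m h x') => //; exact: pact_funE.
Qed.

Lemma embed_borel : borel_fun embed.
Proof.
apply: borel_fun_lip => n g e; apply: borel_open.
(* For e > 1 truncation makes the sublevel set everything. Otherwise it is a union of the open sets
   of [hitting_open], and openness allows uncountably many [h]. *)
have [e1|e1] := leP e 1; last first.
  rewrite (_ : mkset _ = setT); first exact: openT.
  apply/seteqP; split=> // x _ /=.
  by apply: le_lt_trans e1; case/andP: (dist_set_bounds l (hitting n x) g).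
rewrite (_ : mkset _ = \bigcup_(h in [set h | l (g / h)%g < e]) [set x | hitting n x h]).
  by apply: bigcup_open => h _; exact: hitting_open.
apply/seteqP; split=> x /=.
  by move=> /(dist_set_lt _ _ _ e1)[h hx he]; exists h.
by move=> [h he hx]; apply/(dist_set_lt _ _ _ e1); exists h.
Qed.

Lemma embed_borel_isomorphic :
  borel_isomorphic m (induced_pact (lip_action l) (range embed)).
Proof.
pose Y : set (lipSpace l) := range embed.
pose phi (x : X) : Y := exist _ (embed x) (mem_set (imageT embed x)).
have phi_ex (y : Y) : exists x, embed x = val y.
  by have [x _ xy] := set_mem (valP y); exists x.
have [psi psiP] := choice phi_ex.
have phiK : cancel phi psi by move=> x; apply: embed_inj; exact: psiP.
have psiK : cancel psi phi by move=> y; apply: val_inj; exact: psiP.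
(* The equality of options covers undefined values too: [embed_induced] shows that the induced
   action is undefined wherever [m] is. *)
have phiE g x : omap phi (m g x) = induced_fun (lip_action l) g (phi x).
  case e: (m g x) => [y|] /=.
    by apply/esym/induced_funP; exact: esym (embed_equivariant e).
  case e': induced_fun => [z|//].
  move/induced_funP: e' => /=; rewrite -(psiP z) => /embed_induced.
  by rewrite e.
exists phi; split.
- exists psi; split=> //.
  + apply: borel_funP => _ [W oW <-].
    exact: (embed_borel (borel_open oW)).
  + apply: borel_funP => A oA.
    (* A zero at [k] and 1 puts the preimage point in the closure of [V k], hence in [A]. The
       preimage of [A] under [psi] is thus a countable union of closed sets. *)
    pose Z k := if `[< closure (V k) `<=` A >]
      then [set y : Y | val y k 1%g = 0] else set0.
    rewrite (_ : _ @^-1` _ = \bigcup_k Z k).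
      apply: borel_bigcup => k; rewrite /Z; case: ifP => _; last exact: (borel_open open0).
      apply: borel_closed.
      apply: (@closed_comp _ _ (val : Y -> lipSpace l) [set F | F k 1%g = 0]).
        by move=> y _; exact: initial_continuous.
      exact: closed_lip_eq0.
    apply/seteqP; split=> [y Ay|y [k _]].
      have [k yk kA] := @embed_nbhs (psi y) A (open_nbhs_nbhs (conj oA Ay)).
      by exists k => //; rewrite /Z asboolT//= -psiP.
    rewrite /Z; case: ifP => // /asboolP kA /=; rewrite -psiP.
    by move=> /embed_eq0[z]; rewrite pact1 => -[<-] /kA.
- move=> g; apply/seteqP; split=> [_ [x gx <-]|y].
    by move: gx; rewrite /pact_set /= -phiE; case: (m g^-1%g x).
  rewrite /pact_set /= -{1}(psiK y) -phiE => gy; exists (psi y); last exact: psiK.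
  by move=> /= e; rewrite e in gy.
- by move=> g x _; exact: phiE.
Qed.

End embedding.

Theorem mainTheorem2 (R : realType) (G : topologicalGroupType)
    (hG : polish R G) :
  exists (U : topologicalType) (u : global_action G U),
    [/\ polish R U,
        continuous_action u &
        forall (X : topologicalType) (m : partial_action G X),
          polish R X -> continuous_pact m -> clopen (pact_dom m) ->
          exists Y : set U, borel_isomorphic m (induced_pact u Y)].
Proof.
have [l] := length_frame_exists hG.
exists (lipSpace l), (lip_action l); split.
- exact: lip_polish.
- exact: lip_action_continuous.
move=> X m pX cm clm; have [V [oV bV]] := polish_basis pX.
by exists (range (embed l m V)); exact: embed_borel_isomorphic.
Qed.
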